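(* Let $\Sigma=\{\mu\colon2\to1,\ \eta\colon0\to1,\ \delta\colon1\to2,\ \epsilon\colon1\to0\}$, and let $\tau,\tau'\colon n\to m$ be two $\Sigma$-terms of the same type. Then $\tau$ and $\tau'$ are equal as morphisms of $\mathbf{Th(ESCFM)}$, the prop for extraspecial commutative Frobenius monoids, if and only if they map to the same corelation $n\to m$ under the canonical interpretation of $\Sigma$-terms in the prop $\mathbf{Corel}$.
   Context: A prop is a symmetric strict monoidal category whose objects are the natural numbers and whose tensor product on objects is addition. $\Sigma$-terms are built inductively from the empty term $\varnothing\colon0\to0$ (the identity on $0$), $\mathrm{id}\colon1\to1$, the braiding $s\colon2\to2$, and the generators in $\Sigma$, using composition $\circ$ and monoidal sum $+$. **$\mathbf{Th(ESCFM)}$** is the prop freely generated by $\Sigma$ subject to the equations - commutative monoid: $\mu\circ(\mu+\mathrm{id})=\mu\circ(\mathrm{id}+\mu)$, $\mu\circ(\eta+\mathrm{id})=\mathrm{id}$, $\mu\circ s=\mu$; - cocommutative comonoid: $(\delta+\mathrm{id})\circ\delta=(\mathrm{id}+\delta)\circ\delta$, $(\epsilon+\mathrm{id})\circ\delta=\mathrm{id}$, $s\circ\delta=\delta$; - Frobenius law: $(\mathrm{id}+\mu)\circ(\delta+\mathrm{id})=\delta\circ\mu=(\mu+\mathrm{id})\circ(\mathrm{id}+\delta)$; - special law: $\mu\circ\delta=\mathrm{id}$; - extra law: $\epsilon\circ\eta=\varnothing$. **$\mathbf{Corel}$** is the prop whose morphisms $n\to m$ are corelations, i.e. partitions of the disjoint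 union $n+m$ (viewing $n$ as an $n$-element set). The composite of $\alpha\colon n\to m$ and $\beta\colon m\to p$ is the restriction to $n+p$ of the finest partition of $n+m+p$ that is coarser than $\alpha$ and $\beta$ when restricted to $n+m$ and $m+p$ respectively. The monoidal product is disjoint union, and the braiding $2\to2$ is the corelation induced by the swap bijection. **Canonical interpretation.** $\Sigma$-terms are interpreted in $\mathbf{Corel}$ by sending $\varnothing$, $\mathrm{id}$, $s$, $\circ$ and $+$ to the corresponding structure of the prop $\mathbf{Corel}$, and each of the generators $\mu,\eta,\delta,\epsilon$ to the corelation of its type having exactly one equivalence class, i.e. the one-block partition of $2+1$, $0+1$, $1+2$, $1+0$ respectively. *)

(* Defs.v *)
From mathcomp Require Import all_boot all_fingroup.
Set Implicit Arguments.
Unset Strict Implicit.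
Unset Printing Implicit Defensive.

Declare Scope term_scope.
Delimit Scope term_scope with term.

Section Terms.
Variable S : nat -> nat -> Type.

Inductive term : nat -> nat -> Type :=
| tempty : term 0 0
| tid : term 1 1
| tswap : term 2 2
| tgen n m : S n m -> term n m
| tcomp n m p : term m p -> term n m -> term n p
| tsum n m n' m' : term n m -> term n' m' -> term (n + n') (m + m').

(* The monoidal sum on objects is associative and right unital only up to
   propositional equality of natural numbers. *)
Definition castt n m n' m' (e : (n = n') * (m = m')) (t : term n m) :
    term n' m' :=
  let: (en, em) := e in
  ecast k (term n' k) em (ecast k (term k m) en t).

Fixpoint tidn n : term n n :=
  if n is k.+1 then tsum tid (tidn k) else tempty.

(* The braidings n + m -> m + n of any prop are determined, through the
   hexagon identities, by the braiding [tswap] on 1 + 1. *)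
Fixpoint braid1 m : term m.+1 (m + 1) :=
  if m is k.+1 then tcomp (tsum tid (braid1 k)) (tsum tswap (tidn k)) else tid.

Fixpoint braid n m : term (n + m) (m + n) :=
  match n return term (n + m) (m + n) with
  | 0 => castt (erefl m, esym (addn0 m)) (tidn m)
  | k.+1 =>
    castt (erefl (k.+1 + m), esym (addnA m 1 k))
      (tcomp (tsum (braid1 m) (tidn k)) (tsum tid (braid k m)))
  end.

End Terms.

Arguments tempty {S}.
Arguments tid {S}.
Arguments tswap {S}.
Arguments tidn {S} n.
Arguments braid1 {S} m.
Arguments braid {S} n m.

Notation "g \o f" := (tcomp g f) : term_scope.
Notation "f + g" := (tsum f g) : term_scope.

Section FreeProp.
Variable S : nat -> nat -> Type.
Variable E : forall n m, term S n m -> term S n m -> Prop.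
Local Open Scope term_scope.

(* Equality of morphisms in the prop freely generated by [S] subject to [E]:
   the least congruence on terms that contains [E] and makes the quotient a
   symmetric strict monoidal category. *)
Inductive prop_eq : forall n m, term S n m -> term S n m -> Prop :=
| pe_eqn n m (f g : term S n m) : E f g -> prop_eq f g
| pe_refl n m (f : term S n m) : prop_eq f f
| pe_sym n m (f g : term S n m) : prop_eq f g -> prop_eq g f
| pe_trans n m (f g h : term S n m) :
    prop_eq f g -> prop_eq g h -> prop_eq f h
| pe_comp n m p (g g' : term S m p) (f f' : term S n m) :
    prop_eq g g' -> prop_eq f f' -> prop_eq (g \o f) (g' \o f')
| pe_sum n m n' m' (f g : term S n m) (f' g' : term S n' m') :
    prop_eq f g -> prop_eq f' g' -> prop_eq (f + f') (g + g')
| pe_compA n m p q (h : term S p q) (g : term S m p) (f : term S n m) :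
    prop_eq (h \o (g \o f)) ((h \o g) \o f)
| pe_compidl n m (f : term S n m) : prop_eq (tidn m \o f) f
| pe_compidr n m (f : term S n m) : prop_eq (f \o tidn n) f
| pe_sumid n m : prop_eq (tidn n + tidn m) (tidn (n + m))
| pe_interchange n m p n' m' p' (g : term S m p) (f : term S n m)
    (g' : term S m' p') (f' : term S n' m') :
    prop_eq ((g \o f) + (g' \o f')) ((g + g') \o (f + f'))
| pe_sumA n m n' m' n'' m'' (f : term S n m) (g : term S n' m')
    (h : term S n'' m'') :
    prop_eq (castt (addnA n n' n'', addnA m m' m'') (f + (g + h)))
            ((f + g) + h)
| pe_sum0l n m (f : term S n m) : prop_eq (tempty + f) f
| pe_sum0r n m (f : term S n m) :
    prop_eq (castt (addn0 n, addn0 m) (f + tempty)) f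
| pe_braid_nat n m n' m' (f : term S n m) (g : term S n' m') :
    prop_eq (braid m m' \o (f + g)) ((g + f) \o braid n n')
| pe_braidK n m : prop_eq (braid m n \o braid n m) (tidn (n + m))
| pe_hexagon n m p :
    prop_eq (castt (addnA n m p, esym (addnA m p n)) (braid n (m + p)))
            ((tidn m + braid n p)
              \o castt (erefl (n + m + p)%N, esym (addnA m n p))
                   (braid n m + tidn p)).

End FreeProp.

Inductive Sigma : nat -> nat -> Type :=
| mu : Sigma 2 1
| eta : Sigma 0 1
| delta : Sigma 1 2
| epsilon : Sigma 1 0.

Section ESCFM.
Local Open Scope term_scope.
Let mu := tgen mu.
Let eta := tgen eta.
Let delta := tgen delta.
Let epsilon := tgen epsilon.

Inductive ESCFM : forall n m, term Sigma n m -> term Sigma n m -> Prop :=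
| mu_assoc : @ESCFM 3 1 (mu \o (mu + tid)) (mu \o (tid + mu))
| mu_unit : @ESCFM 1 1 (mu \o (eta + tid)) tid
| mu_comm : @ESCFM 2 1 (mu \o tswap) mu
| delta_coassoc : @ESCFM 1 3 ((delta + tid) \o delta) ((tid + delta) \o delta)
| delta_counit : @ESCFM 1 1 ((epsilon + tid) \o delta) tid
| delta_cocomm : @ESCFM 1 2 (tswap \o delta) delta
| frobenius_l : @ESCFM 2 2 ((tid + mu) \o (delta + tid)) (delta \o mu)
| frobenius_r : @ESCFM 2 2 (delta \o mu) ((mu + tid) \o (tid + delta))
| special : @ESCFM 1 1 (mu \o delta) tid
| extra : @ESCFM 0 0 (epsilon \o eta) tempty.

End ESCFM.

Definition eq_Th_ESCFM n m : term Sigma n m -> term Sigma n m -> Prop :=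
  @prop_eq Sigma ESCFM n m.

Section Partitions.
Implicit Types T U : finType.

Definition coarser T (P Q : {set {set T}}) : bool :=
  [forall A in Q, exists B in P, A \subset B].

(* Restriction of a partition of [U] along an injection [T -> U]. *)
Definition restriction T U (f : T -> U) (P : {set {set U}}) : {set {set T}} :=
  [set f @^-1: B | B : {set U} in P] :\ set0.

Lemma partition_inj_eq T (P : {set {set T}}) (A B : {set T}) x :
  trivIset P -> A \in P -> B \in P -> x \in A -> x \in B -> A = B.
Proof.
by move=> tP PA PB xA xB; rewrite -(def_pblock tP PA xA) (def_pblock tP PB xB).
Qed.

Lemma partition_intro T (P : {set {set T}}) :
  (forall x, exists2 A, A \in P & x \in A) ->
  (forall A B x, A \in P -> B \in P -> x \in A -> x \in B -> A = B) ->
  set0 \notin P -> partition P [set: T].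
Proof.
move=> cP tP P0; rewrite /partition P0 andbT; apply/andP; split.
  apply/eqP/setP=> x; rewrite inE; have [A PA xA] := cP x.
  by apply/bigcupP; exists A.
apply/trivIsetP=> A B PA PB neqAB; apply/pred0P=> x /=.
by apply: contraNF neqAB => /andP[xA xB]; rewrite (tP A B x).
Qed.

Lemma restriction_partition T U (f : T -> U) (P : {set {set U}}) :
  partition P [set: U] -> partition (restriction f P) [set: T].
Proof.
move=> pP; apply: partition_intro.
- move=> x; have xP : f x \in cover P by rewrite (cover_partition pP) inE.
  exists (f @^-1: pblock P (f x)); last by rewrite inE mem_pblock.
  rewrite !inE imset_f ?pblock_mem // andbT.
  by apply/set0Pn; exists x; rewrite inE mem_pblock.
- move=> A B x /setD1P[_ /imsetP[A' PA' ->]] /setD1P[_ /imsetP[B' PB' ->]].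
  rewrite !inE => xA xB.
  by rewrite (partition_inj_eq (partition_trivIset pP) PA' PB' xA xB).
- by rewrite !inE eqxx.
Qed.

End Partitions.

Definition corel n m : Type :=
  {P : {set {set 'I_n + 'I_m}} | partition P [set: 'I_n + 'I_m]}.

Section Composition.
Variables n m p : nat.

Definition inj12 (x : 'I_n + 'I_m) : 'I_n + 'I_m + 'I_p := inl x.
Definition inj23 (x : 'I_m + 'I_p) : 'I_n + 'I_m + 'I_p :=
  match x with inl j => inl (inr j) | inr k => inr k end.
Definition inj13 (x : 'I_n + 'I_p) : 'I_n + 'I_m + 'I_p :=
  match x with inl i => inl (inl i) | inr k => inr k end.

Variables (beta : corel m p) (alpha : corel n m).

Definition coarsening (Q : {set {set 'I_n + 'I_m + 'I_p}}) : bool :=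
  [&& partition Q [set: 'I_n + 'I_m + 'I_p],
      coarser (restriction inj12 Q) (val alpha) &
      coarser (restriction inj23 Q) (val beta)].

Definition finest_coarsening (Q : {set {set 'I_n + 'I_m + 'I_p}}) : bool :=
  coarsening Q && [forall Q', coarsening Q' ==> coarser Q' Q].

Lemma finest_coarsening_exists : exists Q, finest_coarsening Q.
Proof.
pose R x y := [forall Q, coarsening Q ==> (pblock Q x == pblock Q y)].
have Req : {in [set: 'I_n + 'I_m + 'I_p] & &, equivalence_rel R}.
  move=> x y z _ _ _; split; first by apply/forallP=> Q; rewrite eqxx implybT.
  move=> /forallP Rxy; apply/forallP/forallP => Rz Q; apply/implyP=> cQ.
    by rewrite -(eqP (implyP (Rxy Q) cQ)) (implyP (Rz Q) cQ).
  by rewrite (eqP (implyP (Rxy Q) cQ)) (implyP (Rz Q) cQ).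
pose M := equivalence_partition R setT.
have pM : partition M setT by apply: equivalence_partitionP.
have inM x y : (y \in pblock M x) = R x y.
  by apply: (pblock_equivalence_partition Req); rewrite inE.
have coarserM k l (A : corel k l) (f : 'I_k + 'I_l -> 'I_n + 'I_m + 'I_p) :
    (forall Q, coarsening Q -> coarser (restriction f Q) (val A)) ->
    coarser (restriction f M) (val A).
  move=> cA; apply/forall_inP=> C AC.
  have /set0Pn[c Cc] := partition_neq0 (valP A) AC.
  have cM x : f x \in cover M by rewrite (cover_partition pM) inE.
  apply/exists_inP; exists (f @^-1: pblock M (f c)).
    rewrite !inE imset_f ?pblock_mem // andbT.
    by apply/set0Pn; exists c; rewrite inE mem_pblock.
  apply/subsetP=> x Cx; rewrite inE inM; apply/forallP=> Q; apply/implyP=> cQ.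
  have /exists_inP[_ /setD1P[_ /imsetP[B QB ->]] /subsetP sCB] :=
    forall_inP (cA Q cQ) C AC.
  have := sCB _ Cc; have := sCB _ Cx; rewrite !inE => xB cB.
  have tQ := let: And3 _ tQ _ := and3P (let: And3 pQ _ _ := and3P cQ in pQ) in tQ.
  by rewrite (def_pblock tQ QB xB) (def_pblock tQ QB cB).
exists M; apply/andP; split.
  by apply/and3P; split=> //; apply: coarserM => Q /and3P[].
apply/forallP=> Q; apply/implyP=> cQ; apply/forall_inP=> A MA.
have /set0Pn[a Aa] := partition_neq0 pM MA.
have pQ : partition Q setT by case/and3P: cQ.
have cvQ x : x \in cover Q by rewrite (cover_partition pQ) inE.
apply/exists_inP; exists (pblock Q a); first exact: pblock_mem.
apply/subsetP=> x; rewrite -(def_pblock (partition_trivIset pM) MA Aa) inM.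
by move=> /forallP/(_ Q); rewrite cQ => /eqP->; rewrite mem_pblock.
Qed.

Definition glue : {set {set 'I_n + 'I_m + 'I_p}} :=
  xchoose finest_coarsening_exists.

Lemma glueP : finest_coarsening glue.
Proof. exact: xchooseP. Qed.

Lemma glue_partition : partition glue [set: 'I_n + 'I_m + 'I_p].
Proof. by case/andP: glueP => /and3P[]. Qed.

Definition corel_comp : corel n p :=
  exist _ (restriction inj13 glue) (restriction_partition inj13 glue_partition).

End Composition.

Section Sum.
Variables n m n' m' : nat.

Definition inj_l (x : 'I_n + 'I_m) : 'I_(n + n') + 'I_(m + m') :=
  match x with inl i => inl (lshift n' i) | inr j => inr (lshift m' j) end.
Definition inj_r (x : 'I_n' + 'I_m') : 'I_(n + n') + 'I_(m + m') :=
  match x with inl i => inl (rshift n i) | inr j => inr (rshift m j) end.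

Definition disjoint_union (P : {set {set 'I_n + 'I_m}})
    (Q : {set {set 'I_n' + 'I_m'}}) : {set {set 'I_(n + n') + 'I_(m + m')}} :=
  [set inj_l @: A | A : {set _} in P] :|: [set inj_r @: B | B : {set _} in Q].

Lemma inj_l_inj : injective inj_l.
Proof. by case=> i [] j //= [] /val_inj->. Qed.

Lemma inj_r_inj : injective inj_r.
Proof. by case=> i [] j //= [] /addnI/val_inj->. Qed.

Lemma inj_lr x y : inj_l x <> inj_r y.
Proof.
by case: x y => i [] j //= [] eij;
   have := ltn_ord i; rewrite eij ltnNge leq_addr.
Qed.

Lemma disjoint_union_partition P Q :
  partition P [set: 'I_n + 'I_m] -> partition Q [set: 'I_n' + 'I_m'] ->
  partition (disjoint_union P Q) [set: 'I_(n + n') + 'I_(m + m')].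
Proof.
move=> pP pQ.
have inl_ok x : exists2 A, A \in disjoint_union P Q & inj_l x \in A.
  exists (inj_l @: pblock P x); last first.
    by rewrite imset_f // mem_pblock (cover_partition pP) inE.
  by rewrite inE imset_f // pblock_mem // (cover_partition pP) inE.
have inr_ok x : exists2 A, A \in disjoint_union P Q & inj_r x \in A.
  exists (inj_r @: pblock Q x); last first.
    by rewrite imset_f // mem_pblock (cover_partition pQ) inE.
  by rewrite inE orbC imset_f // pblock_mem // (cover_partition pQ) inE.
apply: partition_intro.
- case=> x; rewrite -(splitK x); case: (split x) => i /=.
  + exact: (inl_ok (inl i)).
  + exact: (inr_ok (inl i)).
  + exact: (inl_ok (inr i)).
  + exact: (inr_ok (inr i)).
- move=> A B x /setUP[]/imsetP[A' PA ->] /setUP[]/imsetP[B' PB ->].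
  + move=> /imsetP[a Aa ->] /imsetP[b Bb /inj_l_inj eab].
    rewrite -eab in Bb.
    by rewrite (partition_inj_eq (partition_trivIset pP) PA PB Aa Bb).
  + by move=> /imsetP[a _ ->] /imsetP[b _ /inj_lr].
  + by move=> /imsetP[a _ ->] /imsetP[b _ /esym/inj_lr].
  + move=> /imsetP[a Aa ->] /imsetP[b Bb /inj_r_inj eab].
    rewrite -eab in Bb.
    by rewrite (partition_inj_eq (partition_trivIset pQ) PA PB Aa Bb).
- apply/negP=> /setUP[]/imsetP[A PA /esym/eqP]; rewrite imset_eq0 => A0.
  + by have /negP := partition_neq0 pP PA.
  + by have /negP := partition_neq0 pQ PA.
Qed.

Definition corel_sum (alpha : corel n m) (beta : corel n' m') :
    corel (n + n') (m + m') :=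
  exist _ (disjoint_union (val alpha) (val beta))
    (disjoint_union_partition (valP alpha) (valP beta)).

End Sum.

Section Permutation.
Variables (n : nat) (s : 'S_n).

Definition perm_blocks : {set {set 'I_n + 'I_n}} :=
  [set [set inl i; inr (s i)] | i : 'I_n].

Lemma perm_blocks_partition : partition perm_blocks [set: 'I_n + 'I_n].
Proof.
apply: partition_intro.
- case=> i.
    by exists [set inl i; inr (s i)]; [exact: imset_f | rewrite !inE eqxx].
  exists [set inl (s^-1%g i); inr (s (s^-1%g i))]; first exact: imset_f.
  by rewrite permKV !inE eqxx orbT.
- move=> A B x /imsetP[i _ ->] /imsetP[j _ ->].
  rewrite !inE => /orP[]/eqP-> /orP[]/eqP // [].
  + by move=> ->.
  + by move=> /perm_inj->.
- by apply/negP=> /imsetP[i _ /setP/(_ (inl i))]; rewrite !inE eqxx.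
Qed.

Definition corel_perm : corel n n := exist _ perm_blocks perm_blocks_partition.

End Permutation.

Definition corel_id n : corel n n := corel_perm (1%g : 'S_n).

Definition corel_swap : corel 2 2 := corel_perm (tperm ord0 ord_max : 'S_2).

Lemma one_block_partition n m :
  0 < n + m -> partition [set [set: 'I_n + 'I_m]] [set: 'I_n + 'I_m].
Proof.
move=> nm_gt0; apply: partition_intro.
- by move=> x; exists setT; rewrite inE.
- by move=> A B x /set1P-> /set1P->.
- rewrite inE eq_sym -card_gt0 cardsT card_sum !card_ord.
  exact: nm_gt0.
Qed.

Definition one_block n m (nm_gt0 : 0 < n + m) : corel n m :=
  exist _ [set [set: 'I_n + 'I_m]] (one_block_partition nm_gt0).

Definition interp_gen n m (g : Sigma n m) : corel n m :=
  match g with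
  | mu => @one_block 2 1 isT
  | eta => @one_block 0 1 isT
  | delta => @one_block 1 2 isT
  | epsilon => @one_block 1 0 isT
  end.

Fixpoint interp n m (t : term Sigma n m) : corel n m :=
  match t with
  | tempty => corel_id 0
  | tid => corel_id 1
  | tswap => corel_swap
  | tgen _ _ g => interp_gen g
  | tcomp _ _ _ g f => corel_comp (interp g) (interp f)
  | tsum _ _ _ _ f g => corel_sum (interp f) (interp g)
  end.

(* Main.v *)
Require Import Defs.
From mathcomp Require Import all_boot all_fingroup.
From Stdlib Require Import Setoid Morphisms.

(** Why the theorem holds.

    Interpret a term n -> m as a relation between bit strings of lengths n and
    m, where a generator relates two constant strings carrying the same bit.
    This relation is a complete invariant on both sides.

    On the side of corelations, a partition P of n + m is sent to the set of
    pairs of strings that are constant on its blocks. Two truth values suffice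
    to recover P from this set, because the indicator function of a block is
    constant on blocks ([solves_inj]); and bits on the middle component, as
    required by a composite of relations, exist exactly when the outer bits are
    constant on the blocks of the composite corelation ([solves_comp]), a block
    contained in the middle component being assigned any bit at all. So [interp]
    identifies two terms if and only if [sem] does ([eq_interp_sem]).

    On the side of the prop, [sem] respects all the equations ([eq_Th_sem])
    since relations with concatenation form a prop in which they hold. There
    remains completeness: terms with the same relation are provably equal.
    The Frobenius structure makes the prop compact closed, so an input can be
    bent into an output without loss ([unbend]), and it is enough to treat
    states, i.e. terms 0 -> m. Every state is provably equal to a normal form
    that creates the wires one by one, each new wire being either a copy of an
    existing wire or fresh ([all_normal]). The relation of a normal form tells
    for each new wire whether it is fresh and which wires it may copy; the
    ambiguity in the choice of the copied wire is harmless ([copy_same]), so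
    normal forms with the same relation are equal by induction on m
    ([sem_complete_state]).

    The existence of normal forms rests on the calculus of two operations on n
    wires, with an extra wire in front: [copy n j] duplicates wire j to the
    front, and [merge n j] fuses the front wire with wire j. Copies commute
    with each other ([copy_copy]), and every generator other than the counit,
    applied to the front wires, can be moved past a copy ([slides]). Wires are
    only permuted by swaps of the two front wires, so no coherence theorem for
    permutations enters the proof. *)

Set Implicit Arguments.
Unset Strict Implicit.
Unset Printing Implicit Defensive.

Local Open Scope term_scope.

(** * Terms as relations between bit strings *)

(** Strings rather than functions on ordinals: concatenation is associative and
    unital on the nose, so the casts in the equations of a prop disappear. *)
Fixpoint sem n m (t : term Sigma n m) (x y : seq bool) : Prop :=
  match t with
  | tempty => x = [::] /\ y = [::]
  | tid => exists a, x = [:: a] /\ y = [:: a]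
  | tswap => exists a b, x = [:: a; b] /\ y = [:: b; a]
  | tgen n m _ => exists a, x = nseq n a /\ y = nseq m a
  | tcomp _ _ _ g f => exists2 z, sem f x z & sem g z y
  | tsum _ _ _ _ f g => exists x1 x2 y1 y2,
      [/\ x = x1 ++ x2, y = y1 ++ y2, sem f x1 y1 & sem g x2 y2]
  end.

Lemma sem_size n m (t : term Sigma n m) x y :
  sem t x y -> size x = n /\ size y = m.
Proof.
elim: t x y => [|||k l g|k l p g IHg f IHf|k l k' l' f IHf g IHg] x y /=.
- by move=> [-> ->].
- by move=> [a [-> ->]].
- by move=> [a [b [-> ->]]].
- by move=> [a [-> ->]]; rewrite !size_nseq.
- by move=> [z /IHf[-> _] /IHg[_ ->]].
- move=> [x1 [x2 [y1 [y2 [-> -> /IHf[<- <-] /IHg[<- <-]]]]]].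
  by rewrite !size_cat.
Qed.

Lemma sem_castt n m n' m' (e : (n = n') * (m = m')) (t : term Sigma n m) x y :
  sem (castt e t) x y <-> sem t x y.
Proof. by case: e => en em; case: n' / en; case: m' / em. Qed.

Lemma sem_tidn n x y : sem (tidn n) x y <-> size x = n /\ y = x.
Proof.
elim: n x y => [|n IH] x y /=.
  by split=> [[-> ->]//|[/size0nil-> ->]].
split=> [[x1 [x2 [y1 [y2 [-> -> [a [-> ->]] /IH[<- ->]]]]]]//|[]].
case: x => [//|a x] [sx] ->; exists [:: a], x, [:: a], x; split=> //.
  by exists a.
exact/IH.
Qed.

Lemma cat_inj_size (T : Type) (x1 x2 y1 y2 : seq T) :
  size x1 = size y1 -> x1 ++ x2 = y1 ++ y2 -> x1 = y1 /\ x2 = y2.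
Proof. by elim: x1 y1 => [|a x1 IH] [|b y1] //= [/IH{}IH] [-> /IH[-> ->]]. Qed.

Lemma size_eqD (T : Type) n m (x : seq T) : size x = (n + m)%N ->
  exists x1 x2, [/\ x = x1 ++ x2, size x1 = n & size x2 = m].
Proof.
move=> sx; exists (take n x), (drop n x).
by rewrite cat_take_drop size_drop size_takel sx ?addKn ?leq_addr.
Qed.

Lemma sem_sum_cat n m n' m' (f : term Sigma n m) (g : term Sigma n' m')
    x1 x2 y : size x1 = n ->
  sem (f + g) (x1 ++ x2) y <->
  exists y1 y2, [/\ y = y1 ++ y2, sem f x1 y1 & sem g x2 y2].
Proof.
move=> sx; split=> [|[y1 [y2 [-> fx gx]]]]; last by exists x1, x2, y1, y2.
move=> [x3 [x4 [y1 [y2 [ex -> fx gx]]]]]; have [s1 _] := sem_size fx.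
have [-> ->] := cat_inj_size (etrans sx (esym s1)) ex.
by exists y1, y2.
Qed.

Lemma sem_tid_sum n m (f : term Sigma n m) x y :
  sem (tid + f) x y <-> exists a x' y',
    [/\ x = a :: x', y = a :: y' & sem f x' y'].
Proof.
split=> [[_ [x' [_ [y' [-> -> [a [-> ->]] fx]]]]]|[a [x' [y' [-> -> fx]]]]].
  by exists a, x', y'.
by exists [:: a], x', [:: a], y'; split=> //; exists a.
Qed.

Lemma sem_braid1 m x y : sem (braid1 m) x y <->
  exists a x', [/\ size x' = m, x = a :: x' & y = x' ++ [:: a]].
Proof.
elim: m x y => [|m IH] x y /=.
  split=> [[a [-> ->]]|[a [x' [/size0nil-> -> ->]]]]; last by exists a.
  by exists a, [::].
split.
  move=> [z [x1 [x2 [y1 [y2 [-> -> [a [b [-> ->]]] /sem_tidn[sx ->]]]]]]].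
  move=> /sem_tid_sum[c [x3 [y3 [[-> <-] -> /IH[d [x4 [s4 [-> ->] ->]]]]]]].
  by exists d, (c :: x4); rewrite /= s4.
move=> [a [[|b x'] [//= [sx] -> ->]]]; exists [:: b, a & x'].
  exists [:: a; b], x', [:: b; a], x'; split=> //; first by exists a, b.
  exact/sem_tidn.
apply/sem_tid_sum; exists b, (a :: x'), (x' ++ [:: a]); split=> //.
by apply/IH; exists a, x'.
Qed.

(* Unfolding equations that keep the cast folded, so that [sem_castt] can be
   used on it. *)
Lemma braid0 m :
  braid 0 m = castt (erefl m, esym (addn0 m)) (tidn m) :> term Sigma _ _.
Proof. by []. Qed.

Lemma braidS n m :
  braid n.+1 m = castt (erefl (n.+1 + m)%N, esym (addnA m 1 n))
    ((braid1 m + tidn n) \o (tid + braid n m)) :> term Sigma _ _.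
Proof. by []. Qed.

Lemma sem_braid n m x y : sem (braid n m) x y <->
  exists x1 x2, [/\ size x1 = n, size x2 = m, x = x1 ++ x2 & y = x2 ++ x1].
Proof.
elim: n x y => [|n IH] x y.
  rewrite braid0 sem_castt sem_tidn; split=> [[sx ->]|].
    by exists [::], x; rewrite cats0.
  by move=> [x1 [x2 [/size0nil-> sx -> ->]]]; rewrite cats0.
rewrite braidS sem_castt; split.
  move=> [z /sem_tid_sum[a [x' [_ [-> -> /IH[x1 [x2 [s1 s2 -> ->]]]]]]]].
  rewrite -cat_cons => /sem_sum_cat; rewrite /= s2 => /(_ erefl).
  move=> [y1 [y2 [-> /sem_braid1[b [x3 [s3 [<- <-] ->]]] /sem_tidn[_ ->]]]].
  by exists (a :: x1), x2; rewrite /= s1 -catA.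
move=> [[|a x1] [x2 [//= [s1] s2 -> ->]]]; exists (a :: x2 ++ x1).
  apply/sem_tid_sum; exists a, (x1 ++ x2), (x2 ++ x1); split=> //.
  by apply/IH; exists x1, x2.
exists (a :: x2), x1, (x2 ++ [:: a]), x1; rewrite -catA; split=> //.
  by apply/sem_braid1; exists a, x2.
exact/sem_tidn.
Qed.

(** A relation given by a closed term is an iterated existential over strings of
    bits; [sem_inv] solves the resulting equations between strings. *)
Ltac sem_inv := repeat match goal with
  | H : exists _, _ |- _ => destruct H
  | H : exists2 _, _ & _ |- _ => destruct H
  | H : _ /\ _ |- _ => destruct H
  | H : [/\ _, _, _ & _] |- _ => destruct H
  | H : _ :: _ = _ :: _ |- _ => case: H; intros
  | H : _ = _ |- _ => progress (simpl in H; subst)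
  end.

(** The relational components are solved before the equations that split the
    strings, since they fix the lengths of the pieces. *)
Ltac sem_solve := match goal with
  | |- exists2 _, _ & _ => eexists; sem_solve
  | |- exists _, _ => eexists; sem_solve
  | |- [/\ _, _, _ & _] => split; [| | sem_solve | sem_solve]; reflexivity
  | |- _ /\ _ => split; reflexivity
  end.

Lemma sem_ESCFM n m (f g : term Sigma n m) x y :
  ESCFM f g -> sem f x y <-> sem g x y.
Proof.
case=> {n m f g}; split=> /=.
all: intros; sem_inv; sem_solve.
(* The only bit left free is the one carried by [epsilon \o eta]. *)
Unshelve.
all: exact true.
Qed.

(** Soundness: relations between strings form a symmetric strict monoidal
    category under composition and concatenation, in which the braiding
    exchanges two factors of a concatenation. *)
Lemma eq_Th_sem n m (f g : term Sigma n m) :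
  eq_Th_ESCFM f g -> forall x y, sem f x y <-> sem g x y.
Proof.
elim=> {n m f g} [n m f g /sem_ESCFM//||||||||||||||||].
- by [].
- by move=> n m f g _ IH x y; rewrite IH.
- by move=> n m f g h _ IH1 _ IH2 x y; rewrite IH1.
- move=> n m p g g' f f' _ IHg _ IHf x y.
  by split=> -[z fz gz]; exists z; (apply/IHf || apply/IHg).
- move=> n m n' m' f f' g g' _ IHg _ IHf x y.
  by split=> -[x1 [x2 [y1 [y2 [-> -> fx gx]]]]]; exists x1, x2, y1, y2;
    split=> //; (apply/IHf || apply/IHg).
- move=> n m p q h g f x y; split=> [[u [v]]|[u ? [v]]]; last first.
    by exists v => //; exists u.
  by exists v => //; exists u.
- move=> n m f x y; split=> [[z fz /sem_tidn[_ ->]]//|fx].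
  by exists y => //; apply/sem_tidn; have [] := sem_size fx.
- move=> n m f x y; split=> [[z /sem_tidn[_ ->]]//|fx].
  by exists x => //; apply/sem_tidn; have [] := sem_size fx.
- move=> n m x y; rewrite sem_tidn; split=> [|[/size_eqD[x1 [x2 [-> s1 s2]]] ->]].
    move=> [x1 [x2 [y1 [y2 [-> -> /sem_tidn[<- ->] /sem_tidn[<- ->]]]]]].
    by rewrite size_cat.
  by exists x1, x2, x1, x2; split=> //; apply/sem_tidn.
- move=> n m p n' m' p' g f g' f' x y; split.
    move=> [x1 [x2 [y1 [y2 [-> -> [z1 fz1 gz1] [z2 fz2 gz2]]]]]].
    by exists (z1 ++ z2); [exists x1, x2, z1, z2 | exists z1, z2, y1, y2].
  move=> [_ [x1 [x2 [z1 [z2 [-> -> fz1 fz2]]]]]].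
  have [_ sz1] := sem_size fz1.
  move=> /(sem_sum_cat _ _ _ _ sz1)[y1 [y2 [-> gz1 gz2]]].
  by exists x1, x2, y1, y2; split=> //; [exists z1 | exists z2].
- move=> n m n' m' n'' m'' f g h x y; rewrite sem_castt; split.
    move=> [x1 [_ [y1 [_ [-> -> fx [x2 [x3 [y2 [y3 [-> -> gx hx]]]]]]]]]].
    rewrite !catA; exists (x1 ++ x2), x3, (y1 ++ y2), y3; split=> //.
    by exists x1, x2, y1, y2.
  move=> [_ [x3 [_ [y3 [-> -> [x1 [x2 [y1 [y2 [-> -> fx gx]]]]] hx]]]]].
  rewrite -!catA; exists x1, (x2 ++ x3), y1, (y2 ++ y3); split=> //.
  by exists x2, x3, y2, y3.
- move=> n m f x y; split=> [[_ [x1 [_ [y1 [-> -> [-> ->]]]]]]//|fx].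
  by exists [::], x, [::], y.
- move=> n m f x y; rewrite sem_castt.
  split=> [[x1 [_ [y1 [_ [-> -> ? [-> ->]]]]]]|fx]; first by rewrite !cats0.
  by exists x, [::], y, [::]; rewrite !cats0.
- move=> n m n' m' f g x y; split.
    move=> [_ [x1 [x2 [y1 [y2 [-> -> fx gx]]]]]].
    have [[s1 t1] [s2 t2]] := (sem_size fx, sem_size gx).
    move=> /sem_braid[z1 [z2 [u1 u2 /cat_inj_size ez ->]]].
    have [<- <-] := ez (etrans t1 (esym u1)).
    exists (x2 ++ x1); first by apply/sem_braid; exists x1, x2.
    by exists x2, x1, y2, y1.
  move=> [_ /sem_braid[x1 [x2 [s1 s2 -> ->]]]].
  move=> /(sem_sum_cat _ _ _ _ s2)[y2 [y1 [-> gx fx]]].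
  have [[_ t1] [_ t2]] := (sem_size fx, sem_size gx).
  exists (y1 ++ y2); first by exists x1, x2, y1, y2.
  by apply/sem_braid; exists y1, y2.
- move=> n m x y; rewrite sem_tidn; split.
    move=> [_ /sem_braid[x1 [x2 [s1 s2 -> ->]]]].
    move=> /sem_braid[x3 [x4 [s3 s4 /cat_inj_size ez ->]]].
    have [<- <-] := ez (etrans s2 (esym s3)).
    by rewrite size_cat s1 s2.
  move=> [/size_eqD[x1 [x2 [-> s1 s2]]] ->].
  by exists (x2 ++ x1); apply/sem_braid; [exists x1, x2 | exists x2, x1].
- move=> n m p x y; rewrite sem_castt sem_braid; split.
    move=> [x1 [_ [s1 /size_eqD[x2 [x3 [-> s2 s3]]] -> ->]]].
    exists (x2 ++ x1 ++ x3).
      apply/sem_castt; rewrite !catA.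
      exists (x1 ++ x2), x3, (x2 ++ x1), x3; split=> //.
        by apply/sem_braid; exists x1, x2.
      exact/sem_tidn.
    exists x2, (x1 ++ x3), x2, (x3 ++ x1); rewrite -!catA; split=> //.
      exact/sem_tidn.
    by apply/sem_braid; exists x1, x3.
  move=> [z /sem_castt[x' [x3 [y' [y3 [-> ->]]]]]].
  move=> /sem_braid[x1 [x2 [s1 s2 -> ->]]] /sem_tidn[s3 ->].
  rewrite -catA => /(sem_sum_cat _ _ _ _ s2)[y1 [y2 [-> /sem_tidn[_ ->]]]].
  move=> /sem_braid[x4 [x5 [s4 s5 /cat_inj_size ez ->]]].
  have [<- <-] := ez (etrans s1 (esym s4)).
  by exists x1, (x2 ++ x3); rewrite size_cat s2 s3 -!catA.
Qed.

(** * Corelations as relations between bit strings *)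

Definition assign n m (x y : seq bool) (u : 'I_n + 'I_m) : bool :=
  match u with inl i => nth false x i | inr j => nth false y j end.

Definition block_const (T : finType) (P : {set {set T}}) (w : T -> bool) :=
  forall A u v, A \in P -> u \in A -> v \in A -> w u = w v.

Definition solves n m (P : {set {set 'I_n + 'I_m}}) (x y : seq bool) :=
  [/\ size x = n, size y = m & block_const P (assign x y)].

Lemma block_const_coarser (T : finType) (P Q : {set {set T}}) w :
  coarser Q P -> block_const Q w -> block_const P w.
Proof.
move=> /forall_inP cQP cw A u v PA Au Av.
have /exists_inP[B QB /subsetP sAB] := cQP A PA.
by apply: (cw B); rewrite ?sAB.
Qed.

Lemma block_const_preim (T U : finType) (f : T -> U) P w :
  block_const P w -> block_const (restriction f P) (w \o f)%FUN.
Proof.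
move=> cw A u v /setD1P[_ /imsetP[B PB ->]]; rewrite !inE; exact: cw.
Qed.

(** The kernel of a function that is constant on the blocks of P is coarser than
    P; this yields the coarsenings to which minimality of [glue] is applied. *)
Lemma coarser_restriction (T U : finType) (f : T -> U) (w : U -> bool)
    (P : {set {set T}}) :
  set0 \notin P -> block_const P (w \o f)%FUN ->
  coarser (restriction f (preim_partition w setT)) P.
Proof.
move=> P0 cw; apply/forall_inP=> A PA.
have /set0Pn[a Aa] : A != set0 by apply: contraNneq P0 => <-.
pose Q := preim_partition w setT.
have inQ u v : (v \in pblock Q u) = (w u == w v).
  apply: pblock_equivalence_partition; rewrite ?inE // => x y z _ _ _.
  by split=> // /eqP->.
have aQ : f a \in cover Q.
  by rewrite (cover_partition (preim_partitionP w setT)) inE.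
apply/exists_inP; exists (f @^-1: pblock Q (f a)).
  rewrite !inE imset_f ?pblock_mem // andbT.
  by apply/set0Pn; exists a; rewrite inE mem_pblock.
by apply/subsetP=> v Av; rewrite inE inQ; apply/eqP; apply: (cw A).
Qed.

Lemma block_const_preim_partition (T : finType) (w : T -> bool) :
  block_const (preim_partition w setT) w.
Proof.
by move=> A u v /imsetP[a _ ->]; rewrite !inE => /eqP <- /eqP <-.
Qed.

Lemma partition_set0 (T : finType) (P : {set {set T}}) (D : {set T}) :
  partition P D -> set0 \notin P.
Proof. by case/and3P. Qed.

Lemma seq_of_ord n (f : 'I_n -> bool) :
  exists x, size x = n /\ forall i : 'I_n, nth false x i = f i.
Proof.
exists [seq f i | i <- enum 'I_n]; split.
  by rewrite size_map size_enum_ord.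
by move=> i; rewrite (nth_map i) ?size_enum_ord // nth_ord_enum.
Qed.

Lemma eq_block_const (T : finType) (P : {set {set T}}) (w w' : T -> bool) :
  w =1 w' -> block_const P w -> block_const P w'.
Proof. by move=> e cw A u v PA Au Av; rewrite -!e; apply: (cw A). Qed.

(** From right to left, the assignment of bits to all three components has a
    kernel which is a common coarsening, hence is coarser than the glued
    partition. From left to right, the middle bits are read off from the outer
    ones through the blocks of the glued partition. *)
Lemma solves_comp n m p (alpha : corel n m) (beta : corel m p) x z :
  solves (val (corel_comp beta alpha)) x z <->
  exists2 y, solves (val alpha) x y & solves (val beta) y z.
Proof.
have [/and3P[pG cG12 cG23] minG] := andP (glueP beta alpha).
split=> [[sx sz cw]|[y [sx sy cxy] [_ sz cyz]]]; last first.
  pose w (q : 'I_n + 'I_m + 'I_p) :=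
    match q with inl u => assign x y u | inr k => nth false z k end.
  split=> //; have cw : block_const (glue beta alpha) w.
    apply: block_const_coarser (block_const_preim_partition (w := w)).
    apply: (implyP (forallP minG _)); apply/and3P; split.
    - exact: preim_partitionP.
    - apply: coarser_restriction (partition_set0 (valP alpha)) _.
      exact: eq_block_const cxy.
    - apply: coarser_restriction (partition_set0 (valP beta)) _.
      by apply: eq_block_const cyz; case.
  by apply: eq_block_const (block_const_preim (f := @inj13 n m p) cw); case.
(* A glued block that avoids both outer components gets an arbitrary bit. *)
pose w q := if [pick v | @inj13 n m p v \in pblock (glue beta alpha) q]
            is Some v then assign x z v else false.
have Gq q : q \in cover (glue beta alpha) by rewrite (cover_partition pG) inE.
have wG : block_const (glue beta alpha) w.
  move=> A u v GA Au Av; rewrite /w.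
  by rewrite !(def_pblock (partition_trivIset pG) GA).
have w13 v : w (inj13 m v) = assign x z v.
  rewrite /w; case: pickP => [u Gu|/(_ v)]; last by rewrite mem_pblock Gq.
  apply: (cw (@inj13 n m p @^-1: pblock (glue beta alpha) (inj13 m v))).
  - rewrite !inE imset_f ?pblock_mem ?andbT //.
    by apply/set0Pn; exists v; rewrite inE mem_pblock.
  - by rewrite inE.
  - by rewrite inE mem_pblock.
have [y [sy wy]] := seq_of_ord (fun j => w (inl (inr j))).
exists y; split=> //.
  apply: block_const_coarser cG12 _.
  apply: eq_block_const (block_const_preim (f := @inj12 n m p) wG).
  by move=> [i|j]; rewrite /= ?wy //; apply: (w13 (inl i)).
apply: block_const_coarser cG23 _.
apply: eq_block_const (block_const_preim (f := @inj23 n m p) wG).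
by move=> [j|k]; rewrite /= ?wy //; apply: (w13 (inr k)).
Qed.

Lemma assign_inj_l n m n' m' x1 x2 y1 y2 (u : 'I_n + 'I_m) :
  size x1 = n -> size y1 = m ->
  assign (x1 ++ x2) (y1 ++ y2) (inj_l n' m' u) = assign x1 y1 u.
Proof. by move=> sx sy; case: u => i /=; rewrite nth_cat ?sx ?sy ltn_ord. Qed.

Lemma assign_inj_r n m n' m' x1 x2 y1 y2 (u : 'I_n' + 'I_m') :
  size x1 = n -> size y1 = m ->
  assign (x1 ++ x2) (y1 ++ y2) (inj_r n m u) = assign x2 y2 u.
Proof.
by move=> sx sy; case: u => i /=; rewrite nth_cat ?sx ?sy ltnNge leq_addr addKn.
Qed.

Lemma solves_sum n m n' m' (alpha : corel n m) (beta : corel n' m') x y :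
  solves (val (corel_sum alpha beta)) x y <->
  exists x1 x2 y1 y2, [/\ x = x1 ++ x2, y = y1 ++ y2,
    solves (val alpha) x1 y1 & solves (val beta) x2 y2].
Proof.
split=> [[/size_eqD[x1 [x2 [-> sx1 sx2]]] /size_eqD[y1 [y2 [-> sy1 sy2]]] cw]|].
  exists x1, x2, y1, y2; split=> //; split=> // A u v PA Au Av.
    rewrite -!(@assign_inj_l _ _ n' m' x1 x2 y1 y2) //.
    by apply: (cw (@inj_l n m n' m' @: A)); rewrite ?imset_f // inE imset_f.
  rewrite -!(@assign_inj_r n m n' m' x1 x2 y1 y2) //.
  by apply: (cw (@inj_r n m n' m' @: A)); rewrite ?imset_f // inE orbC imset_f.
move=> [x1 [x2 [y1 [y2 [-> -> [sx1 sy1 c1] [sx2 sy2 c2]]]]]].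
split; rewrite ?size_cat ?sx1 ?sx2 ?sy1 ?sy2 //.
move=> A u v /setUP[]/imsetP[B PB ->] /imsetP[u' Bu ->] /imsetP[v' Bv ->].
  by rewrite !assign_inj_l //; apply: (c1 B).
by rewrite !assign_inj_r //; apply: (c2 B).
Qed.

Lemma solves_perm n (s : 'S_n) x y :
  solves (val (corel_perm s)) x y <->
  [/\ size x = n, size y = n &
      forall i : 'I_n, nth false x i = nth false y (s i)].
Proof.
split=> -[sx sy cw]; split=> //.
  move=> i; apply: (cw [set inl i; inr (s i)] (inl i) (inr (s i))).
  - exact: imset_f.
  - by rewrite !inE eqxx.
  - by rewrite !inE eqxx orbT.
move=> A u v /imsetP[i _ ->]; rewrite !inE.
by move=> /orP[]/eqP-> /orP[]/eqP-> /=; rewrite ?cw.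
Qed.

Lemma solves_one_block n m (nm_gt0 : 0 < n + m) x y :
  solves (val (one_block nm_gt0)) x y <->
  exists a, x = nseq n a /\ y = nseq m a.
Proof.
split=> [[sx sy cw]|[a [-> ->]]]; last first.
  split; rewrite ?size_nseq // => A u v _ _ _.
  by case: u => i; case: v => j /=; rewrite !nth_nseq !ltn_ord.
have c (u v : 'I_n + 'I_m) : assign x y u = assign x y v.
  by apply: (cw setT); rewrite ?inE.
have [a wa] : exists a, forall u : 'I_n + 'I_m, assign x y u = a.
  by move: (nm_gt0) c; case: n m {sx sy cw nm_gt0} => [|n] [|m] //= _ c;
    [exists (@assign 0 m.+1 x y (inr ord0))|
     exists (@assign n.+1 0 x y (inl ord0))|
     exists (@assign n.+1 m.+1 x y (inl ord0))].
exists a; split; apply: (@eq_from_nth _ false); rewrite ?size_nseq // => i.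
  by rewrite sx nth_nseq => lti; rewrite lti -(wa (inl (Ordinal lti))).
by rewrite sy nth_nseq => lti; rewrite lti -(wa (inr (Ordinal lti))).
Qed.

Lemma sem_interp n m (t : term Sigma n m) x y :
  sem t x y <-> solves (val (interp t)) x y.
Proof.
elim: t x y => [|||k l g|k l p g IHg f IHf|k l k' l' f IHf g IHg] x y /=.
- rewrite solves_perm; split=> [[-> ->]|[/size0nil-> /size0nil->]] //.
  by split=> // -[].
- rewrite solves_perm; split=> [[a [-> ->]]|[]].
    by split=> // i; rewrite perm1.
  case: x y => [|a [|? ?]] [|b [|? ?]] //= _ _ /(_ ord0).
  by rewrite perm1 /= => ->; exists b.
- rewrite solves_perm; split=> [[a [b [-> ->]]]|[]].
    split=> // i; case: tpermP => [->|->|] //.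
    by case: i => [[|[|i]] ?] // /eqP; rewrite -?val_eqE // => _ /eqP.
  case: x y => [|a [|b [|? ?]]] [|c [|d [|? ?]]] //= _ _ e.
  exists a, b; move: (e ord0) (e ord_max).
  by rewrite tpermL tpermR /= => -> ->.
- case: g; exact: iff_sym (solves_one_block _ _ _).
- rewrite solves_comp.
  by split=> -[z fz gz]; exists z; (apply/IHf || apply/IHg).
- rewrite solves_sum.
  by split=> -[x1 [x2 [y1 [y2 [-> -> fx gx]]]]]; exists x1, x2, y1, y2;
    split=> //; (apply/IHf || apply/IHg).
Qed.

(** The indicator function of a block of alpha solves alpha, hence beta, so the
    blocks of beta do not cross the boundary of that block. *)
Lemma solves_pblock n m (alpha beta : corel n m) a :
  (forall x y, solves (val alpha) x y -> solves (val beta) x y) ->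
  pblock (val beta) a \subset pblock (val alpha) a.
Proof.
move=> sub; pose w u := u \in pblock (val alpha) a.
have inP (gam : corel n m) u : u \in cover (val gam).
  by rewrite (cover_partition (valP gam)) inE.
have [x [sx wx]] := seq_of_ord (fun i => w (inl i)).
have [y [sy wy]] := seq_of_ord (fun i => w (inr i)).
have wE : w =1 @assign n m x y by case=> i /=; rewrite ?wx ?wy.
have [] := sub x y.
  split=> //; apply: eq_block_const wE _ => A u v PA Au Av; rewrite /w.
  have tA := partition_trivIset (valP alpha).
  by rewrite -!eq_pblock ?inP // (def_pblock tA PA Au) (def_pblock tA PA Av).
move=> _ _ cw; apply/subsetP=> u bu.
have au : a \in pblock (val beta) a by rewrite mem_pblock inP.
have := cw _ _ _ (pblock_mem (inP beta a)) bu au.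
by rewrite -!wE /w mem_pblock inP => e; rewrite e.
Qed.

Lemma partition_pblockE (T : finType) (P : {set {set T}}) :
  partition P setT -> P = [set pblock P a | a in [set: T]].
Proof.
move=> pP; apply/setP=> A; apply/idP/imsetP=> [PA|[a _ ->]].
  have /set0Pn[a Aa] := partition_neq0 pP PA.
  by exists a; rewrite ?(def_pblock (partition_trivIset pP) PA).
by apply: pblock_mem; rewrite (cover_partition pP) inE.
Qed.

Lemma solves_inj n m (alpha beta : corel n m) :
  (forall x y, solves (val alpha) x y <-> solves (val beta) x y) ->
  alpha = beta.
Proof.
move=> e; apply: val_inj; rewrite (partition_pblockE (valP alpha)).
rewrite [RHS](partition_pblockE (valP beta)); apply: eq_imset => a.
by apply/eqP; rewrite eqEsubset !solves_pblock // => x y /e.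
Qed.

Lemma eq_interp_sem n m (t t' : term Sigma n m) :
  interp t = interp t' <-> forall x y, sem t x y <-> sem t' x y.
Proof.
split=> [e x y|e]; first by rewrite !sem_interp e.
by apply: solves_inj => x y; rewrite -!sem_interp.
Qed.

(** * Derived equations for the front wires *)

Notation "f =~= g" := (eq_Th_ESCFM f g) (at level 70) : term_scope.

#[export] Instance eqTh_equiv n m : Equivalence (@eq_Th_ESCFM n m).
Proof.
split; [exact: pe_refl | move=> f g; exact: pe_sym |].
by move=> f g h; exact: pe_trans.
Qed.

Lemma eqTh_refl n m (f : term Sigma n m) : f =~= f.
Proof. by reflexivity. Qed.
#[export] Hint Resolve eqTh_refl : core.

#[export] Instance tcomp_proper n m p :
  Proper (@eq_Th_ESCFM m p ==> @eq_Th_ESCFM n m ==> @eq_Th_ESCFM n p)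
    (@tcomp Sigma n m p).
Proof. by move=> g g' eg f f' ef; apply: pe_comp. Qed.

#[export] Instance tsum_proper n m n' m' :
  Proper (@eq_Th_ESCFM n m ==> @eq_Th_ESCFM n' m' ==>
          @eq_Th_ESCFM (n + n')%N (m + m')%N)
    (@tsum Sigma n m n' m').
Proof. by move=> g g' eg f f' ef; apply: pe_sum. Qed.

#[export] Instance castt_proper n m n' m' (e : (n = n') * (m = m')) :
  Proper (@eq_Th_ESCFM n m ==> @eq_Th_ESCFM n' m') (@castt Sigma n m n' m' e).
Proof. by move: e => [en em]; case: n' / en; case: m' / em. Qed.

Lemma castt_id n m (e : (n = n) * (m = m)) (t : term Sigma n m) : castt e t = t.
Proof. by case: e => en em; rewrite (eq_axiomK en) (eq_axiomK em). Qed.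

Lemma tcompA n m p q (h : term Sigma p q) (g : term Sigma m p)
    (f : term Sigma n m) :
  (h \o g) \o f =~= h \o (g \o f).
Proof. apply: pe_sym. exact: pe_compA. Qed.

Lemma tcomp1l n m (f : term Sigma n m) : tidn m \o f =~= f.
Proof. exact: pe_compidl. Qed.

Lemma tcomp1r n m (f : term Sigma n m) : f \o tidn n =~= f.
Proof. exact: pe_compidr. Qed.

Lemma tidn1 : tidn 1 =~= tid.
Proof. have := @pe_sum0r _ ESCFM _ _ tid; rewrite castt_id; exact. Qed.

Lemma tcomp_tidl n (f : term Sigma n 1) : tid \o f =~= f.
Proof. by rewrite -tidn1 tcomp1l. Qed.

Lemma tcomp_tidr n (f : term Sigma 1 n) : f \o tid =~= f.
Proof. by rewrite -tidn1 tcomp1r. Qed.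

(** Adding a wire on the left keeps the arities in successor form. Together with
    generators acting on the front wires only, it keeps the calculus of this
    part free of casts. *)
Definition lwhisk n m (f : term Sigma n m) : term Sigma n.+1 m.+1 := tid + f.

#[export] Instance lwhisk_proper n m :
  Proper (@eq_Th_ESCFM n m ==> @eq_Th_ESCFM n.+1 m.+1) (@lwhisk n m).
Proof. by move=> f g e; rewrite /lwhisk e. Qed.

Lemma lwhiskM n m p (g : term Sigma m p) (f : term Sigma n m) :
  lwhisk (g \o f) =~= lwhisk g \o lwhisk f.
Proof.
transitivity ((tid \o tid) + (g \o f)); first by rewrite tcomp_tidl.
exact: (pe_interchange _ tid tid g f).
Qed.

Lemma lwhisk1 n : lwhisk (tidn n) = tidn n.+1.
Proof. by []. Qed.

Lemma rwhiskM n m p r (g : term Sigma m p) (f : term Sigma n m) :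
  (g \o f) + tidn r =~= (g + tidn r) \o (f + tidn r).
Proof.
transitivity ((g \o f) + (tidn r \o tidn r)); first by rewrite tcomp1l.
exact: pe_interchange.
Qed.

(** The letter f stands for front. With the idle wires behind the generator, the
    arities compute to successor form whatever their number is. *)
Definition fswap n : term Sigma n.+2 n.+2 := tswap + tidn n.
Definition fdup n : term Sigma n.+1 n.+2 := tgen delta + tidn n.
Definition fmul n : term Sigma n.+2 n.+1 := tgen mu + tidn n.
Definition fnew n : term Sigma n n.+1 := tgen eta + tidn n.
Definition fdrop n : term Sigma n.+1 n := tgen epsilon + tidn n.

(** All the slidings of a generator past a term on the wires behind it are
    instances of this equation. *)
Lemma sum_exchange n m n' m' (f : term Sigma n m) (g : term Sigma n' m') :
  (f + tidn m') \o (tidn n + g) =~= (tidn m + g) \o (f + tidn n').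
Proof.
transitivity (f + g).
  transitivity ((f \o tidn n) + (tidn m' \o g)).
    by symmetry; apply: pe_interchange.
  by rewrite tcomp1l tcomp1r.
transitivity ((tidn m \o f) + (g \o tidn n')); first by rewrite tcomp1l tcomp1r.
exact: pe_interchange.
Qed.

Lemma tid0_sum n m (f : term Sigma n m) : tidn 0 + f =~= f.
Proof. exact: pe_sum0l. Qed.

Lemma tid1_sum n m (f : term Sigma n m) : tidn 1 + f =~= lwhisk f.
Proof. by rewrite tidn1. Qed.

Lemma tid2_sum n m (f : term Sigma n m) : tidn 2 + f =~= lwhisk (lwhisk f).
Proof.
have := @pe_sumA _ ESCFM _ _ _ _ _ _ tid (tidn 1) f; rewrite castt_id => e.
transitivity ((tid + tidn 1) + f); first by [].
by rewrite -e tidn1.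
Qed.

Lemma fswap_nat n m (f : term Sigma n m) :
  fswap m \o lwhisk (lwhisk f) =~= lwhisk (lwhisk f) \o fswap n.
Proof. rewrite -!tid2_sum; exact: (sum_exchange tswap f). Qed.

Lemma fdup_nat n m (f : term Sigma n m) :
  fdup m \o lwhisk f =~= lwhisk (lwhisk f) \o fdup n.
Proof. rewrite -tid2_sum -tid1_sum; exact: (sum_exchange (tgen delta) f). Qed.

Lemma fmul_nat n m (f : term Sigma n m) :
  fmul m \o lwhisk (lwhisk f) =~= lwhisk f \o fmul n.
Proof. rewrite -tid2_sum -tid1_sum; exact: (sum_exchange (tgen mu) f). Qed.

Lemma fnew_nat n m (f : term Sigma n m) : fnew m \o f =~= lwhisk f \o fnew n.
Proof.
rewrite -tid1_sum -{1}(tid0_sum f); exact: (sum_exchange (tgen eta) f).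
Qed.

Lemma fdrop_nat n m (f : term Sigma n m) : fdrop m \o lwhisk f =~= f \o fdrop n.
Proof.
rewrite -tid1_sum -{2}(tid0_sum f); exact: (sum_exchange (tgen epsilon) f).
Qed.

(* For arities given by numerals the cast in the next two lemmas computes away
   at [(erefl, erefl)]. *)
Lemma tsumA n m n' m' n'' m'' (f : term Sigma n m) (g : term Sigma n' m')
    (h : term Sigma n'' m'') e :
  castt e (f + (g + h)) =~= (f + g) + h.
Proof.
case: e => en em; rewrite (eq_irrelevance en (addnA n n' n'')).
by rewrite (eq_irrelevance em (addnA m m' m'')); apply: pe_sumA.
Qed.

Lemma tsum0r n m (f : term Sigma n m) e : castt e (f + tempty) =~= f.
Proof.
case: e => en em; rewrite (eq_irrelevance en (addn0 n)).
by rewrite (eq_irrelevance em (addn0 m)); apply: pe_sum0r.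
Qed.

Lemma lwhisk_sum n m n' m' (f : term Sigma n m) (g : term Sigma n' m') :
  lwhisk (f + g) =~= (tid + f) + g.
Proof. exact: (tsumA tid f g (erefl, erefl)). Qed.

(* [fswapS] up to [fdropS]: with at least one idle wire, the first of these can
   be grouped with the generator, which makes the three-wire equations below
   instances of equations between closed terms. *)
Lemma fswapS n : fswap n.+1 =~= (tswap + tid) + tidn n.
Proof. exact: (tsumA tswap tid (tidn n) (erefl, erefl)). Qed.

Lemma fdupS n : fdup n.+1 =~= (tgen delta + tid) + tidn n.
Proof. exact: (tsumA (tgen delta) tid (tidn n) (erefl, erefl)). Qed.

Lemma fmulS n : fmul n.+1 =~= (tgen mu + tid) + tidn n.
Proof. exact: (tsumA (tgen mu) tid (tidn n) (erefl, erefl)). Qed.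

Lemma fnewS n : fnew n.+1 =~= (tgen eta + tid) + tidn n.
Proof. exact: (tsumA (tgen eta) tid (tidn n) (erefl, erefl)). Qed.

Lemma fdropS n : fdrop n.+1 =~= (tgen epsilon + tid) + tidn n.
Proof. exact: (tsumA (tgen epsilon) tid (tidn n) (erefl, erefl)). Qed.

(* The naturality of the braiding is needed only against a single wire, through
   the braidings of types 0 + 1, 1 + 1 and 2 + 1. *)
Lemma braid01 : braid 0 1 =~= tid.
Proof.
transitivity (@castt Sigma _ _ 1 1 (erefl 1, esym (addn0 1)) (tidn 1)).
  exact: eqTh_refl.
by rewrite castt_id tidn1.
Qed.

Lemma tid2 : tid + tid =~= tidn 2.
Proof. rewrite -{2}tidn1. by []. Qed.

Lemma braid1_1 : braid1 1 =~= tswap.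
Proof.
transitivity ((tid + tid) \o (tswap + tempty) : term Sigma 2 2); first by [].
rewrite tid2 tcomp1l.
have := @tsum0r _ _ tswap (erefl, erefl); exact.
Qed.

Lemma braid11 : braid 1 1 =~= tswap.
Proof.
transitivity (@castt Sigma _ _ 2 2 (erefl 2, esym (addnA 1 1 0))
  ((braid1 1 + tempty) \o (tid + braid 0 1))); first by [].
rewrite castt_id braid01 tid2 tcomp1r.
have := @tsum0r _ _ (braid1 1) (erefl, erefl) => /= ->; exact: braid1_1.
Qed.

Lemma braid21 : braid 2 1 =~= (tswap + tid) \o (tid + tswap).
Proof.
transitivity (@castt Sigma _ _ 3 3 (erefl 3, esym (addnA 1 1 1))
  ((braid1 1 + tidn 1) \o (tid + braid 1 1))); first by [].
rewrite castt_id braid11 tidn1 braid1_1; exact: eqTh_refl.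
Qed.

Lemma rwhisk_eq r n m (f g : term Sigma n m) :
  f =~= g -> f + tidn r =~= g + tidn r.
Proof. by move=> ->. Qed.

Lemma tidn_sum n m : tidn n + tidn m =~= tidn (n + m)%N.
Proof. exact: pe_sumid. Qed.

Lemma ESCFM_eq n m (f g : term Sigma n m) : ESCFM f g -> f =~= g.
Proof. exact: pe_eqn. Qed.

Lemma fswapK n : fswap n \o fswap n =~= tidn n.+2.
Proof.
have := @pe_braidK _ ESCFM 1 1; rewrite braid11 => /(rwhisk_eq n).
rewrite rwhiskM => e.
transitivity (tidn (1 + 1)%N + tidn n : term Sigma n.+2 n.+2).
  exact: e.
exact: (tidn_sum 2 n).
Qed.

(** Yang-Baxter: naturality of the braiding 2 + 1 -> 1 + 2 at the swap. *)
Lemma fswap_braid n : fswap n.+1 \o (lwhisk (fswap n) \o fswap n.+1) =~=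
  lwhisk (fswap n) \o (fswap n.+1 \o lwhisk (fswap n)).
Proof.
have := @pe_braid_nat _ ESCFM _ _ _ _ tswap tid.
rewrite braid21 tcompA => /(rwhisk_eq n).
by rewrite !rwhiskM -(fswapS n) -(lwhisk_sum tswap (tidn n)).
Qed.

Lemma fswap_fdup n :
  lwhisk (fdup n) \o fswap n =~= fswap n.+1 \o (lwhisk (fswap n) \o fdup n.+1).
Proof.
have := @pe_braid_nat _ ESCFM _ _ _ _ (tgen delta) tid.
rewrite braid21 braid11 tcompA => /(rwhisk_eq n).
by rewrite !rwhiskM -(fswapS n) -(fdupS n) -(lwhisk_sum tswap (tidn n))
  -(lwhisk_sum (tgen delta) (tidn n)) => ->.
Qed.

Lemma fswap_fmul n :
  fswap n \o fmul n.+1 =~= lwhisk (fmul n) \o (fswap n.+1 \o lwhisk (fswap n)).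
Proof.
have := @pe_braid_nat _ ESCFM _ _ _ _ (tgen mu) tid.
rewrite braid21 braid11 => /(rwhisk_eq n).
by rewrite !rwhiskM -(fswapS n) -(fmulS n) -(lwhisk_sum tswap (tidn n))
  -(lwhisk_sum (tgen mu) (tidn n)) => ->.
Qed.

Lemma fswap_fnew n : fswap n \o fnew n.+1 =~= lwhisk (fnew n).
Proof.
have := @pe_braid_nat _ ESCFM _ _ _ _ (tgen eta) tid.
rewrite braid01 braid11 tcomp_tidr => /(rwhisk_eq n).
by rewrite !rwhiskM -(fnewS n) -(lwhisk_sum (tgen eta) (tidn n)) => ->.
Qed.

Lemma fdrop_fswap n : lwhisk (fdrop n) \o fswap n =~= fdrop n.+1.
Proof.
have := @pe_braid_nat _ ESCFM _ _ _ _ (tgen epsilon) tid.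
rewrite braid01 braid11 tcomp_tidl => /(rwhisk_eq n).
by rewrite !rwhiskM -(fdropS n) -(lwhisk_sum (tgen epsilon) (tidn n)) => ->.
Qed.

Lemma fmul_fnew n : fmul n \o fnew n.+1 =~= tidn n.+1.
Proof. by have /(rwhisk_eq n) := ESCFM_eq mu_unit; rewrite !rwhiskM -fnewS. Qed.

Lemma fmul_comm n : fmul n \o fswap n =~= fmul n.
Proof. by have /(rwhisk_eq n) := ESCFM_eq mu_comm; rewrite !rwhiskM. Qed.

Lemma fdup_coassoc n : fdup n.+1 \o fdup n =~= lwhisk (fdup n) \o fdup n.
Proof.
have /(rwhisk_eq n) := ESCFM_eq delta_coassoc.
by rewrite !rwhiskM -(fdupS n) -(lwhisk_sum (tgen delta) (tidn n)).
Qed.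

Lemma fdrop_fdup n : fdrop n.+1 \o fdup n =~= tidn n.+1.
Proof. by have /(rwhisk_eq n) := ESCFM_eq delta_counit; rewrite !rwhiskM -fdropS. Qed.

Lemma fdup_cocomm n : fswap n \o fdup n =~= fdup n.
Proof. by have /(rwhisk_eq n) := ESCFM_eq delta_cocomm; rewrite !rwhiskM. Qed.

Lemma frobenius_fl n : lwhisk (fmul n) \o fdup n.+1 =~= fdup n \o fmul n.
Proof.
have /(rwhisk_eq n) := ESCFM_eq frobenius_l.
by rewrite !rwhiskM -(fdupS n) -(lwhisk_sum (tgen mu) (tidn n)).
Qed.

Lemma frobenius_fr n : fmul n.+1 \o lwhisk (fdup n) =~= fdup n \o fmul n.
Proof.
have /(rwhisk_eq n) := ESCFM_eq frobenius_r.
by rewrite !rwhiskM -(fmulS n) -(lwhisk_sum (tgen delta) (tidn n)) => ->.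
Qed.

Lemma fmul_fdup n : fmul n \o fdup n =~= tidn n.+1.
Proof. by have /(rwhisk_eq n) := ESCFM_eq special; rewrite !rwhiskM. Qed.

Lemma fdrop_fnew n : fdrop n \o fnew n =~= tidn n.
Proof. by have /(rwhisk_eq n) := ESCFM_eq extra; rewrite !rwhiskM tid0_sum. Qed.

(* Composites are kept nested to the right; the next two lemmas let an equation
   rewrite the leading factors of such a composite. *)
Lemma tcomp_head2 n m p (g : term Sigma m p) (f : term Sigma n m) h :
  g \o f =~= h -> forall l (x : term Sigma l n), g \o (f \o x) =~= h \o x.
Proof. by move=> e l x; rewrite -tcompA e. Qed.

Lemma tcomp_head3 n m p q (h : term Sigma p q) (g : term Sigma m p)
    (f : term Sigma n m) k :
  h \o (g \o f) =~= k ->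
  forall l (x : term Sigma l n), h \o (g \o (f \o x)) =~= k \o x.
Proof. by move=> e l x; rewrite -e !tcompA. Qed.

Lemma lwhisk_fswapK n : lwhisk (fswap n) \o lwhisk (fswap n) =~= tidn n.+3.
Proof. by rewrite -lwhiskM fswapK lwhisk1. Qed.

Lemma fswap_cancel n l (x : term Sigma l _) : fswap n \o (fswap n \o x) =~= x.
Proof. by rewrite (tcomp_head2 (fswapK n)) tcomp1l. Qed.

Lemma lwhisk_fswap_cancel n l (x : term Sigma l _) :
  lwhisk (fswap n) \o (lwhisk (fswap n) \o x) =~= x.
Proof. by rewrite (tcomp_head2 (lwhisk_fswapK n)) tcomp1l. Qed.

Lemma fdup_fswap n :
  lwhisk (fswap n) \o (fswap n.+1 \o lwhisk (fdup n)) =~= fdup n.+1 \o fswap n.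
Proof.
have -> : lwhisk (fdup n) =~=
    fswap n.+1 \o (lwhisk (fswap n) \o (fdup n.+1 \o fswap n)).
  by rewrite (tcomp_head3 (symmetry (fswap_fdup n))) tcompA fswapK tcomp1r.
by rewrite fswap_cancel lwhisk_fswap_cancel.
Qed.

Lemma fmul_fswap n :
  fswap n \o (lwhisk (fmul n) \o fswap n.+1) =~= fmul n.+1 \o lwhisk (fswap n).
Proof.
have -> : lwhisk (fmul n) \o fswap n.+1 =~=
    fswap n \o (fmul n.+1 \o lwhisk (fswap n)).
  by rewrite (tcomp_head2 (fswap_fmul n)) !tcompA lwhisk_fswapK tcomp1r.
by rewrite fswap_cancel.
Qed.

Lemma fswap_natC n m (f : term Sigma n m) l (x : term Sigma l n.+2) :
  lwhisk (lwhisk f) \o (fswap n \o x) =~= fswap m \o (lwhisk (lwhisk f) \o x).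
Proof. by rewrite (tcomp_head2 (symmetry (fswap_nat f))) tcompA. Qed.

(** * Copying and merging with an arbitrary wire *)

(** Reading an index beyond the last wire as a request for a fresh wire lets
    [copy] cover both ways of creating a wire, so that a normal form is a mere
    composite of copies. *)
Fixpoint copy n j : term Sigma n n.+1 :=
  match n, j with
  | 0, _ => fnew 0
  | k.+1, 0 => fdup k
  | k.+1, i.+1 => fswap k \o lwhisk (copy k i)
  end.

Fixpoint merge n j : term Sigma n.+1 n :=
  match n, j with
  | 0, _ => fdrop 0
  | k.+1, 0 => fmul k
  | k.+1, i.+1 => lwhisk (merge k i) \o fswap k
  end.

Lemma copy_fresh n j : n <= j -> copy n j =~= fnew n.
Proof.
elim: n j => [|n IH] [|j] //= /IH ->.
by rewrite -fswap_fnew fswap_cancel.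
Qed.

(** Cocommutativity for two copies of the same wire, and naturality of the swap
    otherwise, with Yang-Baxter in the inductive step. *)
Lemma copy_copy n i j :
  fswap n \o (lwhisk (copy n i) \o copy n j) =~= lwhisk (copy n j) \o copy n i.
Proof.
elim: n i j => [|n IH] i j.
  by rewrite /= -{1}fswap_fnew !tcompA fswap_cancel fnew_nat.
have case0 i' : fswap n.+1 \o (lwhisk (copy n.+1 i'.+1) \o copy n.+1 0) =~=
    lwhisk (copy n.+1 0) \o copy n.+1 i'.+1.
  rewrite /= lwhiskM tcompA -fdup_nat.
  by rewrite (tcomp_head3 (symmetry (fswap_fdup n))) tcompA.
case: i j => [|i] [|j].
- by rewrite /= -fdup_coassoc (tcomp_head2 (fdup_cocomm _)).
- by rewrite -case0 fswap_cancel.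
- exact: case0.
- rewrite /= !lwhiskM !tcompA.
  rewrite !fswap_natC -!lwhiskM.
  by rewrite (tcomp_head3 (fswap_braid n)) !tcompA -(lwhiskM (fswap n)) IH.
Qed.

(** Coassociativity at wire 0, transported to wire i by swaps. It fails for a
    fresh wire, since duplicating it does not create a second one. *)
Lemma copy_coassoc n i : i < n ->
  lwhisk (copy n i) \o copy n i =~= fdup n \o copy n i.
Proof.
elim: n i => [|n IH] [|i] //= lti; first by rewrite fdup_coassoc.
rewrite lwhiskM !tcompA fswap_natC -lwhiskM IH //.
by rewrite lwhiskM (tcomp_head3 (fdup_fswap _)) !tcompA.
Qed.

(** Frobenius law for distant wires: it trades a merge of the two front wires
    for a merge that acts before the copy was made, which is what makes the
    elimination of merges an induction on the number of wires. *)
Lemma frobenius_copy n i : i < n ->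
  fmul n \o lwhisk (copy n i) =~= copy n i \o merge n i.
Proof.
elim: n i => [|n IH] [|i] //= lti; first exact: frobenius_fr.
rewrite !tcompA (tcomp_head2 (symmetry (lwhiskM _ _))) -IH // !lwhiskM !tcompA.
by rewrite -fswap_nat (tcomp_head3 (fmul_fswap _)) tcompA.
Qed.

Lemma fdrop_copy n i : fdrop n \o copy n i =~= tidn n.
Proof.
elim: n i => [|n IH] [|i] /=; rewrite ?fdrop_fnew ?fdrop_fdup //.
by rewrite -fdrop_fswap !tcompA fswap_cancel -lwhiskM IH.
Qed.

(** * Normal forms of states *)

Fixpoint normal m : term Sigma 0 m -> Prop :=
  match m with
  | 0 => fun t => t =~= tempty
  | k.+1 => fun t => exists j t', normal t' /\ t =~= copy k j \o t'
  end.

Lemma normal_eq m (t t' : term Sigma 0 m) : t =~= t' -> normal t -> normal t'.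
Proof.
case: m t t' => [|m] t t' /= e; first by rewrite e.
by move=> [j [u [Nu eu]]]; exists j, u; rewrite -e.
Qed.

Lemma normal_copy m j (t : term Sigma 0 m) : normal t -> normal (copy m j \o t).
Proof. by move=> Nt; exists j, t. Qed.

Definition preserves_normal n m (f : term Sigma n m) :=
  forall t, normal t -> normal (f \o t).

(** A copy taken before f can be taken after f instead. With the preservation of
    normal forms, this property is inherited by [lwhisk f], hence by f applied
    at any position. *)
Definition slides n m (f : term Sigma n m) :=
  preserves_normal f /\
  forall j, exists j', lwhisk f \o copy n j =~= copy m j' \o f.

Lemma slides_id n : slides (tidn n).
Proof.
split=> [t|j]; first by apply: normal_eq; rewrite tcomp1l.
by exists j; rewrite lwhisk1 tcomp1l tcomp1r.
Qed.

Lemma slides_comp n m p (g : term Sigma m p) (f : term Sigma n m) :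
  slides g -> slides f -> slides (g \o f).
Proof.
move=> [Ng Cg] [Nf Cf]; split=> [t /Nf/Ng|j].
  by apply: normal_eq; rewrite tcompA.
have [j1 e1] := Cf j; have [j2 e2] := Cg j1; exists j2.
by rewrite lwhiskM tcompA e1 (tcomp_head2 e2) tcompA.
Qed.

Lemma slides_lwhisk n m (f : term Sigma n m) : slides f -> slides (lwhisk f).
Proof.
move=> [Nf Cf]; split=> [t /= [j [u [Nu e]]]|[|j]].
- have [j' ej] := Cf j; exists j', (f \o u); split; first exact: Nf.
  by rewrite e (tcomp_head2 ej) tcompA.
- by exists 0; rewrite /= fdup_nat.
- have [j' ej] := Cf j; exists j'.+1.
  by rewrite /= fswap_natC -!lwhiskM ej lwhiskM tcompA.
Qed.

Lemma slides_copy n i : slides (copy n i).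
Proof.
split=> [t|j]; first exact: normal_copy.
by exists j.+1; rewrite /= tcompA copy_copy.
Qed.

Lemma slides_fswap n : slides (fswap n).
Proof.
split=> [t [[|i] [u' [/= [j [u [Nu eu]]] e]]]|[|[|j]]] /=.
- exists 0, u'; split; first by exists j, u.
  by rewrite e (tcomp_head2 (fdup_cocomm n)).
- exists j.+1, (copy n i \o u); split; first exact: normal_copy.
  rewrite e eu tcompA fswap_cancel.
  by rewrite (tcomp_head2 (symmetry (copy_copy n j i))) !tcompA.
- by exists 1; rewrite /= tcompA fswap_fdup fswap_cancel.
- by exists 0; rewrite /= fdup_fswap.
- exists j.+2; rewrite /= !lwhiskM !tcompA.
  by rewrite (tcomp_head3 (symmetry (fswap_braid n))) -fswap_nat !tcompA.
Qed.

(** Merging into wire i of n: if the front wire of the normal form was fresh,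
    the merge undoes its creation, and otherwise [frobenius_copy] turns the
    merge of the two front wires into a merge among n wires. *)
Lemma slides_merge n i : i < n -> slides (merge n i).
Proof.
elim: n i => [|n IH] [|i] //= lti; last first.
  by apply: slides_comp (slides_fswap n); apply: slides_lwhisk; apply: IH.
split=> [t [[|i] [u [Nu e]]]|].
- by apply: (@normal_eq n.+1 u) Nu; rewrite e -tcompA fmul_fdup tcomp1l.
- have {}e : fmul n \o t =~= fmul n \o (lwhisk (copy n i) \o u).
    by rewrite e /= -!tcompA fmul_comm.
  have [lt_in|le_ni] := ltnP i n; last first.
    apply: (@normal_eq n.+1 u) Nu; rewrite e copy_fresh // -tcompA.
    by rewrite -(fswap_fnew n) -tcompA fmul_comm fmul_fnew tcomp1l.
  apply: (@normal_eq _ (copy n i \o (merge n i \o u))).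
    by rewrite e -!tcompA frobenius_copy.
  by apply: normal_copy; have [+ _] := IH _ lt_in; apply.
move=> [|[|j]] /=.
- by exists 0; rewrite /= frobenius_fl.
- exists 0; rewrite /= -(fmul_comm n) lwhiskM tcompA fdup_fswap.
  by rewrite (tcomp_head2 (frobenius_fl n)) fmul_comm tcompA fmul_comm.
- exists j.+1; rewrite /= lwhiskM (tcomp_head3 (symmetry (fswap_fmul n))).
  by rewrite !tcompA fmul_nat.
Qed.

(** The counit does not slide, since deleting the source of a copy leaves the
    copy behind. It is therefore used at the front only, where it deletes the
    last created wire; at other positions the wire to be deleted is first moved
    to the front by swaps, which slide. *)
Inductive admissible : forall n m, term Sigma n m -> Prop :=
| admissible_slides n m (f : term Sigma n m) : slides f -> admissible f
| admissible_fdrop n : admissible (fdrop n)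
| admissible_comp n m p (g : term Sigma m p) (f : term Sigma n m) :
    admissible g -> admissible f -> admissible (g \o f)
| admissible_eq n m (f g : term Sigma n m) :
    f =~= g -> admissible f -> admissible g.

Lemma admissible_preserves_normal n m (f : term Sigma n m) :
  admissible f -> preserves_normal f.
Proof.
elim=> {n m f} [n m f []//|n|n m p g f _ IHg _ IHf|n m f g e _ IH] t.
- move=> [j [u [Nu e]]]; apply: normal_eq Nu.
  by rewrite e -tcompA fdrop_copy tcomp1l.
- by move=> /IHf/IHg; apply: normal_eq; rewrite tcompA.
- by move=> /IH; apply: normal_eq; rewrite e.
Qed.

Lemma admissible_lwhisk n m (f : term Sigma n m) :
  admissible f -> admissible (lwhisk f).
Proof.
elim=> {n m f} [n m f gf|n|n m p g f _ IHg _ IHf|n m f g e _ IH].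
- by apply/admissible_slides/slides_lwhisk.
- apply: (@admissible_eq _ _ (fdrop n.+1 \o fswap n)).
    by rewrite -fdrop_fswap tcompA fswapK tcomp1r.
  apply: admissible_comp; first exact: admissible_fdrop.
  exact/admissible_slides/slides_fswap.
- apply: (@admissible_eq _ _ (lwhisk g \o lwhisk f)); first by rewrite lwhiskM.
  exact: admissible_comp.
- by apply: admissible_eq IH; rewrite e.
Qed.

Lemma admissible_tidn_sum k n m (f : term Sigma n m) :
  admissible f -> admissible (tidn k + f).
Proof.
move=> rf; elim: k => [|k IH].
  by apply: admissible_eq rf; rewrite tid0_sum.
exact: admissible_eq (lwhisk_sum (tidn k) f) (admissible_lwhisk IH).
Qed.

Lemma admissible_castt n m n' m' (e : (n = n') * (m = m'))
    (f : term Sigma n m) :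
  admissible f -> admissible (castt e f).
Proof. by case: e => en em; case: n' / en; case: m' / em. Qed.

(** Idle wires on the right are carried through the induction because the sum
    f + g is performed as g, beside the inputs of f, followed by f. *)
Lemma admissible_rwhisk n m (f : term Sigma n m) r : admissible (f + tidn r).
Proof.
elim: f r => [|||k l g|k l p g IHg f IHf|k l k' l' f IHf g IHg] r.
- apply: (@admissible_eq _ _ (tidn r)); first by rewrite tid0_sum.
  exact/admissible_slides/slides_id.
- exact/admissible_slides/(slides_id r.+1).
- exact/admissible_slides/slides_fswap.
- case: g.
  + exact/admissible_slides/(@slides_merge r.+1 0).
  + apply: (@admissible_eq _ _ (copy r r)); first exact: copy_fresh.
    exact/admissible_slides/slides_copy.
  + exact/admissible_slides/(slides_copy r.+1 0).
  + exact: admissible_fdrop.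
- apply: (@admissible_eq _ _ ((g + tidn r) \o (f + tidn r))).
    by rewrite rwhiskM.
  exact: admissible_comp.
- apply: (admissible_eq (pe_sumA _ f g (tidn r))); apply: admissible_castt.
  apply: (@admissible_eq _ _ ((f + tidn (l' + r)%N) \o
                              (tidn k + (g + tidn r)))).
    transitivity ((f \o tidn k) + (tidn (l' + r)%N \o (g + tidn r))).
      by symmetry; apply: pe_interchange.
    by rewrite tcomp1r tcomp1l.
  by apply: admissible_comp; [exact: IHf | exact: admissible_tidn_sum].
Qed.

Lemma normal_castt m m' (e : m = m') (t : term Sigma 0 m) :
  normal t -> normal (castt (erefl 0, e) t).
Proof. by case: m' / e. Qed.

Lemma all_normal m (t : term Sigma 0 m) : normal t.
Proof.
have /admissible_preserves_normal/(_ tempty) := admissible_rwhisk t 0.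
move=> /(_ (eqTh_refl _))/(normal_castt (addn0 m)); apply: normal_eq.
rewrite (tcomp1r (t + tidn 0)).
exact: tsum0r.
Qed.

(** * Completeness of the relational interpretation *)

Lemma sem_fswap n x y : sem (fswap n) x y <->
  exists a b x', [/\ size x' = n, x = [:: a, b & x'] & y = [:: b, a & x']].
Proof.
split=> [[_ [x' [_ [y' [-> -> [a [b [-> ->]]] /sem_tidn[sx ->]]]]]]|].
  by exists a, b, x'.
move=> [a [b [x' [sx -> ->]]]]; exists [:: a; b], x', [:: b; a], x'; split=> //.
  by exists a, b.
exact/sem_tidn.
Qed.

Lemma sem_copy n j x y : sem (copy n j) x y <->
  exists a, [/\ size x = n, y = a :: x & j < n -> a = nth false x j].
Proof.
elim: n j x y => [|n IH] j x y.
  split=> [[_ [_ [_ [_ [-> -> [a [-> ->]] [-> ->]]]]]]|]; first by exists a.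
  move=> [a [/size0nil-> -> _]]; exists [::], [::], [:: a], [::].
  by split=> //; exists a.
case: j => [|j].
  split=> [[_ [x' [_ [y' [-> -> [a [-> ->]] /sem_tidn[<- ->]]]]]]|].
    by exists a.
  case: x => [|b x'] [a [//= [sx] -> /(_ isT) /= ->]].
  exists [:: b], x', [:: b; b], x'; split=> //; first by exists b.
  exact/sem_tidn.
split.
  move=> [_ /sem_tid_sum[b [x' [_ [-> -> /IH[a [sx -> aj]]]]]]].
  by move=> /sem_fswap[b' [a' [z [sz [<- <- <-] ->]]]]; exists a; rewrite /= sx.
move=> [a []]; case: x => [//|b x] /= [sx] -> aj.
exists [:: b, a & x]; last by apply/sem_fswap; exists b, a, x.
by apply/sem_tid_sum; exists b, x, (a :: x); split=> //; apply/IH; exists a.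
Qed.

Lemma sem_comp_copy m j (t : term Sigma 0 m) a x :
  sem (copy m j \o t) [::] (a :: x) <->
  sem t [::] x /\ (j < m -> a = nth false x j).
Proof.
split=> [[z tz /sem_copy[b [_ [-> ->] bj]]]//|[tx aj]].
by exists x => //; apply/sem_copy; exists a; have [_ ->] := sem_size tx.
Qed.

(* The constant string shows that the relation of a state is inhabited. *)
Lemma sem_true n m (t : term Sigma n m) : sem t (nseq n true) (nseq m true).
Proof.
elim: t => [|||k l g|k l p g IHg f IHf|k l k' l' f IHf g IHg] //=.
- by exists true.
- by exists true, true.
- by exists true.
- by exists (nseq l true).
- by exists (nseq k true), (nseq k' true), (nseq l true), (nseq l' true);
    rewrite !nseqD.
Qed.

(** In a normal form, the bits of wires i and j always agree only if both wires
    descend from a common wire by copying; and a copy of a copy can be made at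
    either end, by [copy_coassoc]. *)
Lemma copy_same m (t : term Sigma 0 m) i j : i < m -> j < m ->
  (forall x, sem t [::] x -> nth false x i = nth false x j) ->
  copy m i \o t =~= copy m j \o t.
Proof.
elim: m t i j => // m IH t i j lti ltj eqij.
have [k [u [_ e]]] := all_normal t.
have tu x a : sem u [::] x -> (k < m -> a = nth false x k) ->
    sem t [::] (a :: x).
  by move=> ux ak; apply/(eq_Th_sem e)/sem_comp_copy.
have case0 j' : j' < m ->
    (forall x, sem t [::] x -> nth false x 0 = nth false x j'.+1) ->
    copy m.+1 0 \o t =~= copy m.+1 j'.+1 \o t.
  move=> ltj' e0.
  (* Were wire 0 fresh, its bit could differ from that of wire j'.+1. *)
  have lt_km : k < m.
    rewrite ltnNge; apply/negP => le_mk.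
    have ut := sem_true u.
    have c a : a = nth false (nseq m true) j'.
      by apply: (e0 (a :: _)); apply: tu ut _; rewrite ltnNge le_mk.
    by have := etrans (c true) (esym (c false)).
  have {}e : t =~= copy m j' \o u.
    rewrite e; apply: IH => // x ux.
    by apply: (e0 (nth false x k :: x)); apply: tu.
  rewrite e /= tcompA (tcomp_head3 (copy_copy m j' j')).
  by rewrite (copy_coassoc ltj') tcompA.
case: i j lti ltj eqij => [|i] [|j] lti ltj eqij //.
- exact: case0.
- by rewrite case0 // => x /eqij.
- have eqiju : copy m i \o u =~= copy m j \o u.
    by apply: IH => // x ux; apply: (eqij (nth false x k :: x)); apply: tu.
  have step l : copy m.+1 l.+1 \o (copy m k \o u) =~=
      lwhisk (copy m k) \o (copy m l \o u).
    by rewrite /= tcompA (tcomp_head3 (copy_copy m l k)) tcompA.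
  by rewrite e !step eqiju.
Qed.

(** Deleting the wire created last preserves equality of relations, so the
    remaining states are equal by induction; whether the last wire is fresh, and
    otherwise that both copied wires carry the same bit, is visible in the
    relation. *)
Lemma sem_complete_state m (t t' : term Sigma 0 m) :
  (forall x, sem t [::] x <-> sem t' [::] x) -> t =~= t'.
Proof.
elim: m t t' => [|m IH] t t' same.
  by rewrite (all_normal t) (all_normal t').
have [i [u [_ e]]] := all_normal t; have [j [u' [_ e']]] := all_normal t'.
have tE := eq_Th_sem e; have tE' := eq_Th_sem e'.
have {}same a x : (sem u [::] x /\ (i < m -> a = nth false x i)) <->
                  (sem u' [::] x /\ (j < m -> a = nth false x j)).
  by rewrite -!sem_comp_copy -tE -tE'.
have uu' : u =~= u'.
  apply: IH => x; split=> ux.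
    by have [] := (same (nth false x i) x).1 (conj ux (fun=> erefl)).
  by have [] := (same (nth false x j) x).2 (conj ux (fun=> erefl)).
rewrite e e' -uu'.
have free k l (v v' : term Sigma 0 m) :
    (forall a x, sem v [::] x /\ (k < m -> a = nth false x k) ->
                 sem v' [::] x /\ (l < m -> a = nth false x l)) ->
    m <= k -> m <= l.
  move=> imp le_mk; rewrite leqNgt; apply/negP=> ltl.
  have c a : a = nth false (nseq m true) l.
    have [] := imp a _ (conj (sem_true v) _); first by rewrite ltnNge le_mk.
    by move=> _; apply.
  by have := etrans (c true) (esym (c false)).
have [lti|lei] := ltnP i m.
  have ltj : j < m.
    rewrite ltnNge; apply/negP => /(free _ _ _ _ (fun a x => (same a x).2)).
    by rewrite leqNgt lti.
  apply: copy_same => // x ux.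
  by have [_ ->] := (same (nth false x i) x).1 (conj ux (fun=> erefl)).
by rewrite !copy_fresh // (free _ _ _ _ (fun a x => (same a x).1) lei).
Qed.

(** The first input becomes the first output, by means of the unit of the
    self-duality of the object 1. *)
Definition bend n m (f : term Sigma n.+1 m) : term Sigma n m.+1 :=
  lwhisk f \o (fdup n \o fnew n).

(** The snake equation, from the Frobenius law with unit and counit. *)
Lemma unbend n m (f : term Sigma n.+1 m) :
  fdrop m \o (fmul m \o lwhisk (bend f)) =~= f.
Proof.
rewrite /bend !lwhiskM (tcomp_head2 (fmul_nat f)) tcompA.
rewrite (tcomp_head2 (fdrop_nat f)) tcompA (tcomp_head2 (frobenius_fr n)).
rewrite tcompA (tcomp_head2 (fdrop_fdup n)) tcomp1l.
by rewrite -(fswap_fnew n) (tcomp_head2 (fmul_comm n)) fmul_fnew tcomp1r.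
Qed.

Lemma sem_complete n m (f g : term Sigma n m) :
  (forall x y, sem f x y <-> sem g x y) -> f =~= g.
Proof.
elim: n m f g => [|n IH] m f g same; first exact: sem_complete_state.
rewrite -(unbend f) -(unbend g) (IH _ (bend f) (bend g)) // => x y.
split=> -[z xz /sem_tid_sum[a [x' [y' [ez -> /same fxy]]]]].
  by exists z => //; apply/sem_tid_sum; exists a, x', y'.
by exists z => //; apply/sem_tid_sum; exists a, x', y'.
Qed.

Theorem corollary6p4 (n m : nat) (tau tau' : term Sigma n m) :
  eq_Th_ESCFM tau tau' <-> interp tau = interp tau'.
Proof.
rewrite eq_interp_sem; split; [exact: eq_Th_sem | exact: sem_complete].
Qed.
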